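(* Assume that the Coxeter group $\mathcal W$ is nonabelian and irreducible. Then the action of $\mathcal G$ on itself by conjugation has no nontrivial finite orbits (the only finite orbits are singletons consisting of central elements). In particular, the center of any finite index subgroup of $\mathcal G$ is either trivial or equal to $\langle\Delta\rangle$, the latter only if $\Delta$ is central in $\mathcal G$.
   Context: Let $S$ be a finite set, $m$ a Coxeter matrix on $S$ with finite Coxeter group $\mathcal W=\langle S\mid (ss')^{m(s,s')}=1\rangle$, and $\mathcal A=\langle S\mid ss's\cdots=s'ss'\cdots\ (m(s,s')\text{ letters each side})\rangle$ the Artin group. $\mathcal W$ is irreducible if there is no nontrivial partition $S=S_1\sqcup S_2$ with $m(s_1,s_2)=2$ for all $s_1\in S_1$, $s_2\in S_2$. $\Delta\in\mathcal A$ is the positive lift of the longest element of $\mathcal W$ (the element of the submonoid generated by $S$ mapping to the longest element with the same word length); $\Delta^2$ is central, $\mathcal G=\mathcal A/\langle\Delta^2\rangle$, and $\langle\Delta\rangle\subset\mathcal G$ denotes the order-two subgroup generated by the image of $\Delta$. *)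

(* Defs.v *)
(* groups given by presentations, encoded as words modulo
   the congruence generated by free reductions and the defining relations. *)
From mathcomp Require Import all_boot.
Set Implicit Arguments. Unset Strict Implicit. Unset Printing Implicit Defensive.

Section Presentations.
Variable S : finType.

(* a letter is a generator s (false) or its formal inverse s^-1 (true) *)
Definition word := seq (S * bool).

Definition pos (p : seq S) : word := map (fun s => (s, false)) p.

Definition winv (w : word) : word := rev (map (fun x => (x.1, ~~ x.2)) w).

Inductive peq (R : word -> word -> Prop) : word -> word -> Prop :=
| peq_refl w : peq R w w
| peq_sym u v : peq R u v -> peq R v u
| peq_trans u v w : peq R u v -> peq R v w -> peq R u w
| peq_free u v s b : peq R (u ++ [:: (s, b); (s, ~~ b)] ++ v) (u ++ v)
| peq_rel u v l r : R l r -> peq R (u ++ l ++ v) (u ++ r ++ v).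

Definition alt (s t : S) (n : nat) : seq S :=
  mkseq (fun i => if odd i then t else s) n.

Definition CoxeterMatrix (m : S -> S -> nat) : Prop :=
  forall s t, m s t = m t s /\ (m s t == 1) = (s == t) /\ (s != t -> 2 <= m s t).

(* relations of the Coxeter group W: (s t)^{m(s,t)} = 1 (so s^2 = 1) *)
Definition coxRel (m : S -> S -> nat) (l r : word) : Prop :=
  exists s t, l = pos (alt s t (2 * m s t)) /\ r = [::].

Definition artinRel (m : S -> S -> nat) (l r : word) : Prop :=
  exists s t, l = pos (alt s t (m s t)) /\ r = pos (alt t s (m s t)).

(* relations of G = A / <Delta^2>, Delta represented by the positive word d *)
Definition gRel (m : S -> S -> nat) (d : seq S) (l r : word) : Prop :=
  artinRel m l r \/ (l = pos d ++ pos d /\ r = [::]).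

Definition Coxeq m := peq (coxRel m).
Definition Geq m d := peq (gRel m d).

Definition FiniteW (m : S -> S -> nat) : Prop :=
  exists ws : seq word, forall w, exists2 u, u \in ws & Coxeq m w u.

Definition NonabelianW (m : S -> S -> nat) : Prop :=
  exists u v : word, ~ Coxeq m (u ++ v) (v ++ u).

Definition IrreducibleW (m : S -> S -> nat) : Prop :=
  forall A : {set S}, A != set0 -> A != setT ->
    exists s t, [/\ s \in A, t \notin A & m s t != 2].

(* d is a positive lift of the longest element: its image in W has length
   size d (d is reduced) and every element of W has length <= size d. *)
Definition IsDelta (m : S -> S -> nat) (d : seq S) : Prop :=
  (forall p : seq S, Coxeq m (pos p) (pos d) -> size d <= size p) /\
  (forall w : word, exists p : seq S, size p <= size d /\ Coxeq m (pos p) w).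

Definition conjw (h g : word) : word := h ++ g ++ winv h.

Definition finite_conj_orbit (R : word -> word -> Prop) (g : word) : Prop :=
  exists os : seq word, forall h, exists2 u, u \in os & peq R (conjw h g) u.

Definition central (R : word -> word -> Prop) (g : word) : Prop :=
  forall h, peq R (h ++ g) (g ++ h).

Definition IsSubgroup (R : word -> word -> Prop) (H : word -> Prop) : Prop :=
  [/\ forall u v, peq R u v -> H u -> H v,
      H [::],
      forall u v, H u -> H v -> H (u ++ v)
    & forall u, H u -> H (winv u)].

Definition FiniteIndex (R : word -> word -> Prop) (H : word -> Prop) : Prop :=
  exists ts : seq word, forall w, exists2 t, t \in ts &
    exists h, H h /\ peq R w (h ++ t).

Definition centerOf (R : word -> word -> Prop) (H : word -> Prop) (z : word) : Prop :=
  H z /\ forall h, H h -> peq R (z ++ h) (h ++ z).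

End Presentations.

(* Main.v *)
(* The theorem reduces to statements on the Artin monoid [A+], with Garside element
   [Delta] and [E = Delta^2].  Replacing each [s^-1] by the positive word [q] with
   [s q = q s = E] turns a word into an element of [A+], and two words are equal in
   [G] iff their images agree up to powers of the central element [E].

   If the conjugacy orbit of [g] is finite then, by the pigeonhole principle and
   comparison of lengths, the positive representative [a] of [g] commutes with some
   power of each generator [s].  In [A+], [a s^n = t^n a] implies [a s = t a]:
   a letter [u <> t] dividing [a] also divides [t^n a], which forces the
   [(m u t - 1)]-letter alternating word starting with [u] to divide [a], and it can
   be pushed through both sides.  So [a] is central.  When [W] is irreducible, the
   set of generators dividing a central [a <> 1] is everything, so [Delta] divides
   [a], and [a] is a power of [Delta].  Elements of the center of a finite index
   subgroup have finite orbits, so they are trivial or equal to [Delta].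

   Cancellation and lcms in [A+] are proved by induction on the length; the case of
   three letters is compared with reduced words dividing [Delta], which the exchange
   condition and Matsumoto's theorem control. *)
Require Import Defs.
From HB Require Import structures.
From mathcomp Require Import all_boot all_algebra all_field ring boolp.
Set Implicit Arguments. Unset Strict Implicit. Unset Printing Implicit Defensive.
Local Open Scope group_scope.

(** * Monoids given by a presentation *)

Section PresentedMonoid.
Variables (S : finType) (R : seq S -> seq S -> Prop).

Inductive ceq : seq S -> seq S -> Prop :=
| ceq_refl p : ceq p p
| ceq_sym p q : ceq p q -> ceq q p
| ceq_trans p q r : ceq p q -> ceq q r -> ceq p r
| ceq_rel u v l r : R l r -> ceq (u ++ l ++ v) (u ++ r ++ v).

Lemma ceq_ctx a b p q : ceq p q -> ceq (a ++ p ++ b) (a ++ q ++ b).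
Proof.
elim=> [{}p|{}p {}q _|{}p {}q r _ pq _ qr|u v l r Rlr]; first exact: ceq_refl.
- exact: ceq_sym.
- exact: ceq_trans pq qr.
by have := ceq_rel (a ++ u) (v ++ b) Rlr; rewrite -!catA.
Qed.

Lemma ceq_cat p p' q q' : ceq p p' -> ceq q q' -> ceq (p ++ q) (p' ++ q').
Proof.
move=> /(ceq_ctx [::] q) /= pp /(ceq_ctx p' [::]); rewrite !cats0.
exact: ceq_trans.
Qed.

Definition ceqb p q := `[< ceq p q >].

Lemma ceqb_refl : reflexive ceqb.
Proof. by move=> p; apply/asboolP; exact: ceq_refl. Qed.

Lemma ceqb_sym : symmetric ceqb.
Proof. by move=> p q; apply/asboolP/asboolP; exact: ceq_sym. Qed.

Lemma ceqb_trans : transitive ceqb.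
Proof.
move=> q p r /asboolP pq /asboolP qr; apply/asboolP; exact: ceq_trans pq qr.
Qed.

Canonical ceqb_equiv := EquivRel ceqb ceqb_refl ceqb_sym ceqb_trans.

Definition pmon := {eq_quot ceqb}%qT.
HB.instance Definition _ := Choice.on pmon.

Definition wd (p : seq S) : pmon := (\pi_{eq_quot ceqb} p)%qT.

Lemma wdP p q : wd p = wd q <-> ceq p q.
Proof. by split=> [/eqmodP/asboolP|pq] //; apply/eqmodP/asboolP. Qed.

Lemma wd_repr (x : pmon) : wd (repr x) = x.
Proof. exact: reprK. Qed.

Definition pmon_mul (x y : pmon) : pmon := wd (repr x ++ repr y).

Lemma pmon_mulE p q : pmon_mul (wd p) (wd q) = wd (p ++ q).
Proof. by apply/wdP/ceq_cat; apply/wdP; rewrite wd_repr. Qed.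

Lemma pmon_mulA : associative pmon_mul.
Proof.
by move=> x y z; rewrite -(wd_repr x) -(wd_repr y) -(wd_repr z) !pmon_mulE catA.
Qed.

Lemma pmon_mul1 : left_id (wd [::]) pmon_mul.
Proof. by move=> x; rewrite -(wd_repr x) pmon_mulE. Qed.

Lemma pmon_1mul : right_id (wd [::]) pmon_mul.
Proof. by move=> x; rewrite -(wd_repr x) pmon_mulE cats0. Qed.

HB.instance Definition _ := isMonoid.Build pmon pmon_mulA pmon_mul1 pmon_1mul.

Lemma wd_cat p q : wd (p ++ q) = wd p * wd q.
Proof. by rewrite -pmon_mulE. Qed.

Lemma wd_cons s p : wd (s :: p) = wd [:: s] * wd p.
Proof. by rewrite -wd_cat. Qed.

Lemma wd_nseq n s : wd (nseq n s) = wd [:: s] ^+ n.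
Proof. by elim: n => //= n IH; rewrite wd_cons IH expgS. Qed.

End PresentedMonoid.

(** * Alternating words in two letters *)

Section Alternating.
Variable S : finType.
Implicit Types s t : S.

Lemma size_alt s t n : size (alt s t n) = n.
Proof. exact: size_mkseq. Qed.

Lemma altS s t n : alt s t n.+1 = s :: alt t s n.
Proof.
rewrite /alt /mkseq /= (iotaDl 1 0) -map_comp; congr (_ :: _).
by apply: eq_map => i /=; case: (odd i).
Qed.

Lemma alt_add s t n k :
  alt s t (n + k) = alt s t n ++ (if odd n then alt t s k else alt s t k).
Proof.
by elim: n s t => // n IH s t; rewrite addSn !altS IH /=; case: (odd n).
Qed.

Lemma altSr s t n : alt s t n.+1 = alt s t n ++ [:: if odd n then t else s].
Proof. by rewrite -addn1 alt_add; case: (odd n). Qed.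

Lemma rev_alt s t n : rev (alt s t n) = if odd n then alt s t n else alt t s n.
Proof.
elim: n s t => // n IH s t; rewrite {1}altS rev_cons IH -cats1 !altSr /=.
by case: (odd n).
Qed.

End Alternating.

(** * The Coxeter group *)

Section CoxeterGroup.
Variables (S : finType) (m : S -> S -> nat).

(* The relations [s s = 1] are the case [m s s = 1] of the others; stated apart,
   they make [coxeter m] a group for every [m]. *)
Definition coxeter_rel (l r : seq S) : Prop :=
  r = [::] /\ ((exists s, l = [:: s; s]) \/ exists s t, l = alt s t (2 * m s t)).

Definition coxeter := pmon coxeter_rel.
HB.instance Definition _ := Monoid.on coxeter.

Definition cw (p : seq S) : coxeter := wd coxeter_rel p.

Lemma cw_cat p q : cw (p ++ q) = cw p * cw q. Proof. exact: wd_cat. Qed.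
Lemma cw_cons s p : cw (s :: p) = cw [:: s] * cw p. Proof. exact: wd_cons. Qed.

Lemma cw_sq s : cw [:: s] * cw [:: s] = 1.
Proof.
rewrite -cw_cat; apply/wdP/(@ceq_rel _ _ [::] [::] [:: s; s] [::]).
by split=> //; left; exists s.
Qed.

Lemma cw_alt2 s t : cw (alt s t (2 * m s t)) = 1.
Proof.
apply/wdP; rewrite -[alt _ _ _]cats0.
apply: (@ceq_rel _ _ [::] [::] (alt s t (2 * m s t)) [::]).
by split=> //; right; exists s, t.
Qed.

Lemma cw_revV p : cw (rev p) * cw p = 1.
Proof.
elim: p => [|s p IH]; first by rewrite -cw_cat.
by rewrite rev_cons -cats1 cw_cat (cw_cons s p) mulgA -(mulgA (cw (rev p)))
  cw_sq mulg1.
Qed.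

Definition cox_inv (x : coxeter) : coxeter := cw (rev (repr x)).

Lemma cox_mulVg : left_inverse 1 cox_inv *%g.
Proof. by move=> x; rewrite -{2}(wd_repr x); exact: cw_revV. Qed.

Lemma cox_mulgV : right_inverse 1 cox_inv *%g.
Proof.
move=> x; rewrite -{1}(wd_repr x) -{1}(revK (repr x)); exact: cw_revV.
Qed.

HB.instance Definition _ := hasInv.Build coxeter cox_inv.
HB.instance Definition _ := Monoid_isGroup.Build coxeter cox_mulVg cox_mulgV.

Lemma cw_rev p : cw (rev p) = (cw p)^-1.
Proof. by rewrite -[RHS]mul1g -(cw_revV p) mulgK. Qed.

Lemma cw_sV s : (cw [:: s])^-1 = cw [:: s].
Proof. by rewrite -cw_rev. Qed.

Lemma cw_inj_l p q r : cw (p ++ q) = cw (p ++ r) -> cw q = cw r.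
Proof. by rewrite !cw_cat => /mulgI. Qed.

Definition conjs (g r : coxeter) := g * r * g^-1.

Lemma conjs_inj g : injective (conjs g).
Proof. by move=> r r' /mulIg/mulgI. Qed.

Lemma conjsM g h r : conjs (g * h) r = conjs g (conjs h r).
Proof. by rewrite /conjs invgM !mulgA. Qed.

(* The reflections [s_1 .. s_i .. s_1] attached to the prefixes of [p]. *)
Fixpoint refl (p : seq S) : seq coxeter :=
  if p is s :: p' then cw [:: s] :: map (conjs (cw [:: s])) (refl p') else [::].

Lemma size_refl p : size (refl p) = size p.
Proof. by elim: p => //= s p IH; rewrite size_map IH. Qed.

Lemma refl_cat p q : refl (p ++ q) = refl p ++ map (conjs (cw p)) (refl q).
Proof.
elim: p => [|s p IH] /=.
  by rewrite -[LHS]map_id; apply: eq_map => r; rewrite /conjs invg1 mulg1 mul1g.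
rewrite IH map_cat -map_comp; congr (_ :: _ ++ _).
by apply: eq_map => r; rewrite (cw_cons s p) conjsM.
Qed.

Lemma refl_alt s t n :
  refl (alt s t n) = mkseq (fun i => cw (alt s t (2 * i).+1)) n.
Proof.
elim: n s t => // n IH s t; rewrite altS /= IH /mkseq /= (iotaDl 1 0) -!map_comp.
congr (_ :: _); apply: eq_map => i /=.
have -> : (2 * (1 + i)).+1 = (2 * i).+3 by rewrite mulnDr.
rewrite [alt s t _]altS (altSr t s (2 * i).+1) oddS oddM (cw_cons s (_ ++ _)) cw_cat.
by rewrite /conjs cw_sV mulgA.
Qed.

(** The first [2 * m s t] letters have trivial product, so the sequence of reflections has period
    [m s t]. *)
Lemma refl_alt_double s t :
  refl (alt s t (2 * m s t)) = refl (alt s t (m s t)) ++ refl (alt s t (m s t)).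
Proof.
rewrite !refl_alt {1}mul2n -addnn /mkseq iotaD map_cat; congr (_ ++ _).
rewrite addnC iotaDl -map_comp; apply: eq_map => i /=.
by rewrite mulnDr -addnS alt_add cw_cat cw_alt2 mul1g oddM.
Qed.

(** A relator contributes a list of the form [L ++ L], and its product 1 leaves the later
    reflections unchanged, so deleting it changes no parity. *)
Lemma refl_parity p q (r : coxeter) :
  ceq coxeter_rel p q -> odd (count_mem r (refl p)) = odd (count_mem r (refl q)).
Proof.
elim=> [//|? ? _ ->//|? ? ? _ -> _ //|u v l _ [-> lE]] /=.
have lE1 : cw l = 1.
  by case: lE => [[s ->]|[s [t ->]]]; rewrite ?cw_alt2 // cw_cons cw_sq.
have [L LE] : exists L, refl l = L ++ L.
  case: lE => [[s ->]|[s [t ->]]].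
    by exists [:: cw [:: s]]; rewrite /= /conjs mulgK.
  by exists (refl (alt s t (m s t))); exact: refl_alt_double.
rewrite !refl_cat map_cat -map_comp !count_cat !count_map LE.
set f := (X in (_ + (_ + X))%N); set g := (X in (_ = odd (_ + X))).
have -> : f = g.
  by apply: eq_count => x /=; rewrite lE1 /conjs invg1 mulg1 mul1g.
by rewrite count_cat addnn !oddD odd_double.
Qed.

Definition reduced (p : seq S) := forall q, cw q = cw p -> size p <= size q.

(** Deletion property: by the last equation, multiplying [cw p] by [r] on the left deletes the
    letter [a] from [p]. *)
Lemma mem_refl r p : r \in refl p ->
  exists p1 a p2, p = p1 ++ a :: p2 /\ r * cw p1 = cw (p1 ++ [:: a]).
Proof.
elim: p r => //= s p IH r; rewrite inE => /orP[/eqP->|/mapP[r' r'p ->]].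
  by exists [::], s, p; rewrite mulg1.
have [p1 [a [p2 [-> E]]]] := IH _ r'p.
exists (s :: p1), a, p2; split=> //=.
rewrite /conjs cw_sV (cw_cons s p1) -!mulgA (mulgA (cw [:: s]) (cw [:: s])).
by rewrite cw_sq mul1g E -cw_cons.
Qed.

(** By parity, a reflection occurring once in [refl p] occurs in [refl q] for every word [q] of the
    same element. *)
Lemma uniq_reduced p : uniq (refl p) -> reduced p.
Proof.
move=> up q /wdP qp; rewrite -(size_refl p) -(size_refl q).
apply: uniq_leq_size => // r rp.
have := refl_parity r qp; rewrite (count_uniq_mem _ up) rp /= => /odd_gt0.
by rewrite -has_count has_pred1.
Qed.

Lemma reduced_catr p q : reduced (p ++ q) -> reduced q.
Proof.
move=> H q' E; have := H (p ++ q'); rewrite !cw_cat E => /(_ erefl).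
by rewrite !size_cat leq_add2l.
Qed.

Lemma reduced_catl p q : reduced (p ++ q) -> reduced p.
Proof.
move=> H p' E; have := H (p' ++ q); rewrite !cw_cat E => /(_ erefl).
by rewrite !size_cat leq_add2r.
Qed.

Lemma reduced_eq p q : cw p = cw q -> size p = size q -> reduced p -> reduced q.
Proof. by move=> E sz H r; rewrite -E -sz; apply: H. Qed.

Lemma reduced_size p q : cw p = cw q -> reduced p -> reduced q -> size p = size q.
Proof. by move=> E rp rq; apply/eqP; rewrite eqn_leq rp ?rq. Qed.

Lemma reduced_rev p : reduced p -> reduced (rev p).
Proof.
move=> rp q; rewrite cw_rev => E; rewrite size_rev -(size_rev q).
by apply: rp; rewrite cw_rev E invgK.
Qed.

(** Otherwise deleting a letter of [p] would spell the element of [s :: p] with two letters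
    fewer. *)
Lemma mem_refl_cons s p : reduced (s :: p) -> cw [:: s] \notin refl p.
Proof.
move=> rsp; apply/negP => /mem_refl [p1 [a [p2 [pE E]]]].
have E2 : cw (p1 ++ p2) = cw (s :: p).
  rewrite pE cw_cons !cw_cat (cw_cons a) mulgA E cw_cat -!mulgA.
  by rewrite (mulgA (cw [:: a])) cw_sq mul1g.
by have := rsp _ E2; rewrite pE /= !size_cat /= addnS => /ltnW; rewrite ltnn.
Qed.

Lemma reduced_uniq p : reduced p -> uniq (refl p).
Proof.
elim: p => //= s p IH rsp; rewrite (map_inj_uniq (@conjs_inj _)) IH ?andbT.
  apply: contra (mem_refl_cons rsp) => /mapP[r rp E].
  suff -> : cw [:: s] = r by [].
  by apply: (@conjs_inj (cw [:: s])); rewrite -E /conjs mulgK.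
exact: (@reduced_catr [:: s]).
Qed.

(** The exchange condition: without this membership the reflections of [s :: p] would be
    distinct. *)
Lemma not_reduced_cons s p : reduced p -> ~ reduced (s :: p) -> cw [:: s] \in refl p.
Proof.
move=> rp nr; apply/negPn/negP => sp; apply: nr; apply: uniq_reduced => /=.
rewrite (map_inj_uniq (@conjs_inj _)) reduced_uniq // andbT.
apply: contra sp => /mapP[r r' E].
suff -> : cw [:: s] = r by [].
by apply: (@conjs_inj (cw [:: s])); rewrite -E /conjs mulgK.
Qed.

End CoxeterGroup.

(* The action on functions below is dual to the geometric representation; it shows
   that [s t] has order exactly [m s t] in [coxeter m]. *)
Section GeometricRepresentation.
Import GRing.Theory.
Local Open Scope ring_scope.
Variables (S : finType) (m : S -> S -> nat).
Hypothesis Hm : CoxeterMatrix m.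

(** A chosen primitive [n]-th root of unity; the predecessor gives a first root at [n = 0]. *)
Definition zeta (n : nat) : algC := sval (C_prim_root_exists (ltn0Sn n.-1)).

Lemma zetaP n : (0 < n)%N -> n.-primitive_root (zeta n).
Proof. by case: n => // n _; exact: svalP (C_prim_root_exists (ltn0Sn n)). Qed.

(* [2 cos (pi / m s t)], up to a Galois conjugation *)
Definition bond s t : algC := zeta (2 * m s t) + (zeta (2 * m s t))^-1.

(** A move of Mozes's numbers game. *)
Definition fire (f : {ffun S -> algC}) (s : S) : {ffun S -> algC} :=
  [ffun u => if u == s then - f s else f u + bond s u * f s].

Definition act (p : seq S) (f : {ffun S -> algC}) := foldl fire f p.

Lemma fire_invol s f : fire (fire f s) s = f.
Proof.
apply/ffunP=> u; rewrite !ffunE eqxx; case: eqP => [->|_]; first by rewrite opprK.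
by rewrite mulrN addrK.
Qed.

Section Pair.
Variables (s t : S).
Hypothesis st : s != t.

Let z := zeta (2 * m s t).
Let T f := fire (fire f s) t.

Lemma m_ge2 : (2 <= m s t)%N.
Proof. by have [_ [_ /(_ st)]] := Hm s t. Qed.

Lemma zeta_prim : (2 * m s t).-primitive_root z.
Proof. by apply: zetaP; have := m_ge2; case: (m s t). Qed.

Lemma zeta_neq0 : z != 0.
Proof.
apply/eqP=> z0; have := prim_expr_order zeta_prim; rewrite z0 expr0n.
have := m_ge2; case: (m s t) => // n _ /eqP.
by rewrite eq_sym oner_eq0.
Qed.

Lemma zeta2_neq1 : z ^+ 2 != 1.
Proof.
rewrite -(prim_order_dvd zeta_prim) gtnNdvd //.
by apply: leq_trans (_ : 2 * 2 <= _)%N => //; rewrite leq_mul2l m_ge2.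
Qed.

Lemma ts_neq : t == s = false. Proof. by rewrite eq_sym (negPf st). Qed.

Lemma bond_sym : bond t s = bond s t.
Proof. by rewrite /bond; have [-> _] := Hm t s. Qed.

Lemma fire2_s f : T f s = - f s + bond s t * (f t + bond s t * f s).
Proof. by rewrite !ffunE (negPf st) ts_neq eqxx bond_sym. Qed.

Lemma fire2_t f : T f t = - (f t + bond s t * f s).
Proof. by rewrite !ffunE ts_neq eqxx. Qed.

Lemma fire2_other f u : u != s -> u != t ->
  T f u = f u + bond s u * f s + bond t u * (f t + bond s t * f s).
Proof. by move=> us ut; rewrite !ffunE (negPf us) (negPf ut) ts_neq. Qed.

(* Eigenvectors of [T] on the plane of the coordinates [s] and [t]. *)
Let L (f : {ffun S -> algC}) := f s + z^-1 * f t.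
Let L' (f : {ffun S -> algC}) := f s + z * f t.

Lemma eigen_fire2 f : L (T f) = z ^+ 2 * L f.
Proof. rewrite /L fire2_s fire2_t /bond -/z; field; exact: zeta_neq0. Qed.

Lemma eigen'_fire2 f : L' (T f) = z ^- 2 * L' f.
Proof. rewrite /L' fire2_s fire2_t /bond -/z; field; exact: zeta_neq0. Qed.

Lemma eigen_iter n f : L (iter n T f) = z ^+ (2 * n) * L f.
Proof. by elim: n => [|n IH]; rewrite ?mul1r //= eigen_fire2 IH mulrA -exprD mulnS. Qed.

Lemma eigen'_iter n f : L' (iter n T f) = z ^- (2 * n) * L' f.
Proof.
elim: n => [|n IH]; first by rewrite invr1 mul1r.
by rewrite /= eigen'_fire2 IH mulrA -invfM -exprD mulnS.
Qed.

(* [A] and [B] solve the linear system which makes [f u + A u * L f + B u * L' f]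
   invariant under [T]. *)
Let A u :=
  (bond t u - (bond s u + bond s t * bond t u) * z) / (z - z^-1) / (z ^+ 2 - 1).
Let B u :=
  ((bond s u + bond s t * bond t u) * z^-1 - bond t u) / (z - z^-1) / (z ^- 2 - 1).

Lemma zeta_subV_neq0 : z - z^-1 != 0.
Proof.
apply: contra zeta2_neq1 => /eqP/subr0_eq zV.
by rewrite expr2 {2}zV divff // zeta_neq0.
Qed.

Lemma invariant_fire2 f u : u != s -> u != t ->
  T f u + A u * L (T f) + B u * L' (T f) = f u + A u * L f + B u * L' f.
Proof.
move=> us ut; rewrite eigen_fire2 eigen'_fire2 fire2_other // /A /B /L /L'.
have -> : bond s t = z + z^-1 by [].
have z2 : z * z - 1 != 0 by rewrite subr_eq0 zeta2_neq1.
have z3 : 1 + -1 * z ^+ 2 != 0 by rewrite mulN1r subr_eq0 eq_sym zeta2_neq1.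
by field; rewrite z2 z3 zeta_neq0.
Qed.

Lemma invariant_iter n f u : u != s -> u != t ->
  iter n T f u + A u * L (iter n T f) + B u * L' (iter n T f)
  = f u + A u * L f + B u * L' f.
Proof. by move=> us ut; elim: n => //= n <-; rewrite invariant_fire2. Qed.

(** After [m s t] turns both eigenvalues become 1. Since [z] differs from its inverse, this recovers
    [f s] and [f t]; the invariants recover the other coordinates. *)
Lemma fire2_order f : iter (m s t) T f = f.
Proof.
have LE : L (iter (m s t) T f) = L f.
  by rewrite eigen_iter (prim_expr_order zeta_prim) mul1r.
have LE' : L' (iter (m s t) T f) = L' f.
  by rewrite eigen'_iter (prim_expr_order zeta_prim) invr1 mul1r.
have tE : iter (m s t) T f t = f t.
  have LL (g : {ffun S -> algC}) : (z - z^-1) * g t = L' g - L g.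
    by rewrite /L /L'; ring.
  by apply: (mulfI zeta_subV_neq0); rewrite !LL LE LE'.
have sE : iter (m s t) T f s = f s.
  by move: LE; rewrite /L tE => /addIr.
apply/ffunP=> u; case: (eqVneq u s) => [->//|us]; case: (eqVneq u t) => [->//|ut].
by have := invariant_iter (m s t) f us ut; rewrite LE LE' => /addIr/addIr.
Qed.

Lemma act_alt n f : act (alt s t (2 * n)) f = iter n T f.
Proof. by elim: n f => // n IH f; rewrite mulnS !altS iterSr -IH. Qed.

Lemma fire2_iter_neq k : (0 < k < m s t)%N -> exists f, iter k T f <> f.
Proof.
(* [L] is 1 on the indicator of [s], and [k] turns multiply it by [z ^+ (2 * k)], which is not 1
   because [z] has order [2 * m s t]. *)
move=> /andP[k0 km]; exists [ffun u => (u == s)%:R] => E.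
have := eigen_iter k [ffun u => (u == s)%:R].
rewrite E /L !ffunE eqxx ts_neq !mulr0 addr0 mulr1 => /esym/eqP.
rewrite -(prim_order_dvd zeta_prim) gtnNdvd //.
  by rewrite muln_gt0.
by rewrite ltn_pmul2l.
Qed.

End Pair.

Lemma act_ceq p q f : ceq (coxeter_rel m) p q -> act p f = act q f.
Proof.
move=> pq; elim: pq f => [//|? ? _ IH f|? ? ? _ IH _ IH' f|u v l _ [-> lE] f].
- by rewrite IH.
- by rewrite IH IH'.
rewrite /act !foldl_cat; congr foldl.
case: lE => [[s ->]|[s [t ->]]]; first exact: fire_invol.
move: (foldl fire f u) => g; rewrite -/(act _ g).
case: (eqVneq s t) => [<-|st]; last by rewrite act_alt // fire2_order.
have [_ [+ _]] := Hm s s; rewrite eqxx => /eqP ->.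
exact: fire_invol.
Qed.

Lemma cw_alt_neq1 s t k : (0 < k < m s t)%N -> s != t -> cw m (alt s t (2 * k)) <> 1%g.
Proof.
move=> km st /wdP E; have [f] := fire2_iter_neq st km; apply.
by rewrite -act_alt // (act_ceq f E).
Qed.

End GeometricRepresentation.

(** * Reduced words and Matsumoto's theorem *)

Section Matsumoto.
Variables (S : finType) (m : S -> S -> nat).
Hypothesis Hm : CoxeterMatrix m.
Implicit Types (s t : S) (p q r : seq S).
Local Notation cw := (cw m).
Local Notation reduced := (reduced m).

Definition artin_rel (l r : seq S) : Prop :=
  exists s t, l = alt s t (m s t) /\ r = alt t s (m s t).

Definition artin := pmon artin_rel.
HB.instance Definition _ := Monoid.on artin.
Definition aw p : artin := wd artin_rel p.

Lemma aw_cat p q : aw (p ++ q) = aw p * aw q. Proof. exact: wd_cat. Qed.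
Lemma aw_cons s p : aw (s :: p) = aw [:: s] * aw p. Proof. exact: wd_cons. Qed.

(** [alt_pred t s] is the cofactor of [s] in the lcm of [s] and [t]; it is empty for [s = t]. *)
Definition alt_pred s t := alt s t (m s t).-1.

Lemma m_sym s t : m s t = m t s. Proof. by have [] := Hm s t. Qed.

Lemma m_diag s : m s s = 1%N.
Proof. by have [_ [+ _]] := Hm s s; rewrite eqxx => /eqP. Qed.

Lemma m_gt0 s t : 0 < m s t.
Proof.
case: (eqVneq s t) => [->|st]; first by rewrite m_diag.
by apply: ltnW; have [_ [_ ->]] := Hm s t.
Qed.

Lemma alt_predE s t : alt s t (m s t) = s :: alt_pred t s.
Proof. by rewrite /alt_pred (m_sym t s) -altS prednK // m_gt0. Qed.

Lemma alt_pred_diag s : alt_pred s s = [::].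
Proof. by rewrite /alt_pred m_diag. Qed.

Lemma aw_braid s t : aw (alt s t (m s t)) = aw (alt t s (m t s)).
Proof.
apply/wdP; rewrite -[alt s t _]cats0 -[alt t s _]cats0 (m_sym t s).
by apply: (@ceq_rel _ _ [::] [::]); exists s, t.
Qed.

Lemma aw_alt_pred s t : aw [:: s] * aw (alt_pred t s) = aw [:: t] * aw (alt_pred s t).
Proof. by rewrite -!aw_cons -!alt_predE aw_braid. Qed.

Lemma cw_braid s t : cw (alt s t (m s t)) = cw (alt t s (m t s)).
Proof.
apply/divg1_eq; rewrite (m_sym t s) -cw_rev -cw_cat.
by rewrite rev_alt -alt_add addnn -mul2n cw_alt2.
Qed.

Lemma ceq_artin_cw p q : ceq artin_rel p q -> cw p = cw q.
Proof.
elim=> [//|? ? _ ->//|? ? ? _ -> _ //|u v l r [s [t [-> ->]]]].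
by rewrite !cw_cat cw_braid (m_sym t s).
Qed.

Lemma aw_cw p q : aw p = aw q -> cw p = cw q.
Proof. by move/wdP/ceq_artin_cw. Qed.

Lemma aw_size p q : aw p = aw q -> size p = size q.
Proof.
move/wdP; elim=> [//|? ? _ ->//|? ? ? _ -> _ //|u v l r [s [t [-> ->]]]].
by rewrite !size_cat !size_alt.
Qed.

(** For [s <> t], two equal reflections would make a power of [s t] with exponent strictly between 0
    and [m s t] trivial. *)
Lemma reduced_alt s t k : k <= m s t -> reduced (alt s t k).
Proof.
case: (eqVneq s t) => [<-|st km].
  rewrite m_diag; case: k => [|[|//]] _; first by move=> q.
  exact: uniq_reduced.
apply: uniq_reduced; rewrite refl_alt map_inj_in_uniq ?iota_uniq //.
suff H i j : i < j -> j < k -> cw (alt s t (2 * i).+1) <> cw (alt s t (2 * j).+1).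
  move=> i j; rewrite !mem_iota /= !add0n => ik jk E.
  by case: (ltngtP i j) => // ij; [case: (H i j) | case: (H j i)].
move=> ij jk E; apply: (@cw_alt_neq1 _ _ Hm s t (j - i) _ st).
  by rewrite subn_gt0 ij (leq_ltn_trans (leq_subr _ _)) // (leq_trans jk).
apply: (mulIg (cw (alt s t (2 * i).+1))); rewrite mul1g {2}E -cw_cat.
have -> : (2 * j).+1 = (2 * (j - i) + (2 * i).+1)%N.
  by rewrite addnS -mulnDr subnK // ltnW.
by rewrite alt_add oddM.
Qed.

Definition descent s p := exists p1, reduced (s :: p1) /\ cw p = cw (s :: p1).

(** Once [p] is spelled [alt t s k ++ r], the descent [s] allows an exchange. The exchanged letter
    is not in [alt t s k], since [alt s t k.+1] is reduced, so it is removed from [r] and [s] goes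
    to the front. *)
Lemma descent_alt_prefix k s t p : k <= m s t -> s != t -> reduced p ->
  descent s p -> descent t p ->
  exists r, reduced (alt s t k ++ r) /\ cw p = cw (alt s t k ++ r).
Proof.
elim: k s t => [|k IH] s t km st rp ds dt; first by exists p.
have km' : k <= m t s by rewrite (m_sym t s) ltnW.
have ts : t != s by rewrite eq_sym.
have [r [rr pE]] := IH t s km' ts rp dt ds.
have nr : ~ reduced (s :: alt t s k ++ r).
  have [p1 [rp1 pE1]] := ds => /(_ p1).
  rewrite (cw_cons _ s (_ ++ _)) -pE pE1 (cw_cons _ s p1) mulgA cw_sq mul1g.
  move=> /(_ erefl).
  rewrite /= (reduced_size (etrans (esym pE) pE1) rr rp1) /=.
  by move=> /ltnW; rewrite ltnn.
have := not_reduced_cons rr nr; rewrite refl_cat mem_cat => /orP[|].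
  have /mem_refl_cons/negPf -> // : reduced (s :: alt t s k).
  by rewrite -altS; apply: reduced_alt.
move=> /mapP[x xr E]; have [r1 [a [r2 [rE xE]]]] := mem_refl xr.
exists (r1 ++ r2).
have cE : cw p = cw (alt s t k.+1 ++ r1 ++ r2).
  rewrite pE rE altS (cw_cons _ s) E /conjs !cw_cat !mulgA mulgVK (cw_cons _ a).
  by rewrite -(mulgA _ x) xE !cw_cat -!mulgA.
split=> //; apply: reduced_eq rr; first by rewrite -pE.
by rewrite rE !size_cat !size_alt /= addSnnS addnS.
Qed.

(** At the full length [m s t] the two alternating prefixes are equal in the group, so one remainder
    [r] serves both sides. *)
Lemma reduced_lcm s t p q : reduced (s :: p) -> reduced (t :: q) ->
  cw (s :: p) = cw (t :: q) -> exists r, [/\ reduced (alt_pred t s ++ r),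
    reduced (alt_pred s t ++ r), cw p = cw (alt_pred t s ++ r)
    & cw q = cw (alt_pred s t ++ r)].
Proof.
move=> rsp rtq E; case: (eqVneq s t) => [st|st].
  subst t; exists p; rewrite alt_pred_diag; move: E.
  rewrite (cw_cons _ s p) (cw_cons _ s q) => /mulgI E.
  by split=> //; exact: (@reduced_catr _ _ [:: s]).
have [|||r [rr rE]] := @descent_alt_prefix (m s t) s t (s :: p) (leqnn _) st.
- exact: rsp.
- by exists p.
- by exists q.
have rE' : cw (t :: q) = cw (alt t s (m t s) ++ r) by rewrite -E rE !cw_cat cw_braid.
have rr' : reduced (alt t s (m t s) ++ r).
  by apply: reduced_eq rr; rewrite -?rE -?rE' // !size_cat !size_alt m_sym.
exists r; move: rr rE rr' rE'; rewrite !alt_predE !cat_cons => rr rE rr' rE'.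
split.
- exact: (@reduced_catr _ _ [:: s] _ rr).
- exact: (@reduced_catr _ _ [:: t] _ rr').
- by move: rE; rewrite -[s :: p]cat1s -[s :: _]cat1s => /cw_inj_l.
- by move: rE'; rewrite -[t :: q]cat1s -[t :: _]cat1s => /cw_inj_l.
Qed.

(** By induction on the length, the tails can be respelled so that the two words differ by one braid
    relation at the front. *)
Lemma matsumoto p q : reduced p -> reduced q -> cw p = cw q -> aw p = aw q.
Proof.
elim: {p}_.+1 {-2}p (ltnSn (size p)) q => // n IH p pn q rp rq E.
have sz := reduced_size E rp rq.
case: p q sz pn rp rq E => [|s p] [|t q] //= sz pn rp rq E.
have [r [r1 r2 E1 E2]] := reduced_lcm rp rq E.
rewrite aw_cons (aw_cons t) (IH p _ (alt_pred t s ++ r)) //; last first.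
  exact: (@reduced_catr _ _ [:: s]).
rewrite (IH q _ (alt_pred s t ++ r)) -?(eq_add_S _ _ sz) //; last first.
  exact: (@reduced_catr _ _ [:: t]).
by rewrite !aw_cat !mulgA aw_alt_pred.
Qed.

End Matsumoto.

(** * The Artin monoid *)

Section Garside.
Variables (S : finType) (m : S -> S -> nat).
Hypothesis Hm : CoxeterMatrix m.
Variable d : seq S.
Hypothesis d_reduced : reduced m d.
Hypothesis d_longest : forall q, reduced m q -> size q <= size d.
Local Notation M := (artin m).
Implicit Types (s t u : S) (p q r : seq S) (x y z a b : M).
Local Notation gen s := (aw m [:: s]).
Local Notation c s t := (aw m (alt_pred m s t)).
Local Notation Delta := (aw m d).

Definition len x := size (repr x).

Lemma len_aw p : len (aw m p) = size p.
Proof. by apply: (@aw_size _ m); exact: wd_repr. Qed.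

Lemma artin_ind (P : M -> Prop) : P 1 -> (forall s x, P x -> P (gen s * x)) ->
  forall x, P x.
Proof.
move=> P1 PS x; rewrite -(wd_repr x); elim: (repr x) => [|s p IH]; first exact: P1.
by rewrite wd_cons; exact: PS.
Qed.

Lemma lenM x y : len (x * y) = (len x + len y)%N.
Proof. by rewrite -(wd_repr x) -(wd_repr y) -wd_cat !len_aw size_cat. Qed.

Lemma len_gen s x : len (gen s * x) = (len x).+1.
Proof. by rewrite lenM len_aw. Qed.

Lemma len1 : len 1 = 0%N. Proof. exact: (len_aw [::]). Qed.

Lemma lenX x n : len (x ^+ n) = (n * len x)%N.
Proof. by elim: n => [|n IH]; rewrite ?len1 // expgS lenM IH mulSn. Qed.

Lemma artinP x : x = 1 \/ exists s y, x = gen s * y.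
Proof. by elim/artin_ind: x => [|s x _]; [left | right; exists s, x]. Qed.

Lemma len_eq0 x : len x = 0%N -> x = 1.
Proof. by case: (artinP x) => [//|[s [y ->]]]; rewrite lenM len_aw. Qed.

Definition ldvd x y := exists z, y = x * z.

Lemma ldvd_refl x : ldvd x x. Proof. by exists 1; rewrite mulg1. Qed.

Lemma ldvd_trans x y z : ldvd x y -> ldvd y z -> ldvd x z.
Proof. by move=> [a ->] [b ->]; exists (a * b); rewrite mulgA. Qed.

Lemma ldvd_mulr x y : ldvd x (x * y). Proof. by exists y. Qed.

Lemma ldvd_mul2l x y z : ldvd x y -> ldvd (z * x) (z * y).
Proof. by move=> [a ->]; exists a; rewrite mulgA. Qed.

Lemma ldvd1 x : ldvd 1 x. Proof. by exists x; rewrite mul1g. Qed.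

(** * Cancellation and lcms of letters *)

Definition simple x := exists2 p, reduced m p & x = aw m p.

Lemma simple_reduced p : simple (aw m p) -> reduced m p.
Proof.
by case=> q rq E; apply: reduced_eq rq; [rewrite (aw_cw Hm E) | rewrite (aw_size E)].
Qed.

Lemma simpleM x y : simple (x * y) -> simple x /\ simple y.
Proof.
rewrite -(wd_repr x) -(wd_repr y) -wd_cat => /simple_reduced rxy; split.
  by exists (repr x) => //; exact: reduced_catl rxy.
by exists (repr y) => //; exact: reduced_catr rxy.
Qed.

Lemma simple_Delta : simple Delta. Proof. by exists d. Qed.

(** For [s = t] this is cancellation of a first letter; otherwise it makes the braid word the lcm of
    two letters dividing [x]. *)
Definition atom_lcm x := forall s t a b, x = gen s * a -> x = gen t * b ->
  exists z, a = c t s * z /\ b = c s t * z.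

(** All right factors are included so that letters can be stripped from the left in inductions. *)
Definition good x := forall y z, x = y * z -> atom_lcm z.

Lemma goodM x y : good (x * y) -> good y.
Proof. by move=> gxy u v E; apply: (gxy (x * u)); rewrite E mulgA. Qed.

Lemma good_lcm x : good x -> atom_lcm x.
Proof. by move/(_ 1 x); rewrite mul1g; apply. Qed.

(** The property holds for reduced words in the Coxeter group and is lifted by Matsumoto's
    theorem. *)
Lemma simple_good x : simple x -> good x.
Proof.
move=> sx y z E; move: sx; rewrite E => /simpleM[_ sz] s t a b Ea Eb.
have := etrans (esym Ea) Eb; move: (sz) (sz); rewrite {1}Ea Eb.
rewrite -(wd_repr a) -(wd_repr b) -!wd_cat => /simple_reduced r1 /simple_reduced r2 E2.
have [r [ra rb Ear Ebr]] := reduced_lcm Hm r1 r2 (aw_cw Hm E2).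
exists (aw m r); rewrite -!aw_cat; split; apply: matsumoto => //.
  exact: (@reduced_catr _ _ [:: s]).
exact: (@reduced_catr _ _ [:: t]).
Qed.

Lemma good_cancel z x y : good (z * x) -> z * x = z * y -> x = y.
Proof.
elim/artin_ind: z x y => [|s z IH] x y; first by rewrite !mul1g.
rewrite -!mulgA => g E; apply: IH; first exact: goodM g.
have [z' []] := good_lcm g erefl E.
by rewrite alt_pred_diag // => -> ->.
Qed.

(** The point is that one [j] serves both [x] and [b]. With [v = s v'] and [w = t w'], join [v']
    with the cofactor of [s], rewrite [s] times the result as a multiple of [t], and join its tail
    with [w']. *)
Lemma good_join n x b v w : len x <= n -> good x -> good b ->
  ldvd v x -> ldvd v b -> ldvd w x -> ldvd w b ->
  exists j, [/\ ldvd v j, ldvd w j, ldvd j x & ldvd j b].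
Proof.
elim: n x b v w => [|n IH] x b v w xn gx gb vx vb wx wb;
  (case: (artinP v) => [v1|[s [v' vE]]];
    first by exists w; split; rewrite ?v1 //; [exact: ldvd1 | exact: ldvd_refl]);
  (case: (artinP w) => [w1|[t [w' wE]]];
    first by exists v; split; rewrite ?w1 //; [exact: ldvd_refl | exact: ldvd1]).
  by move: vx xn => [z ->]; rewrite vE !lenM len_aw.
have [[xv xvE] [bv bvE] [xw xwE] [bw bwE]] := And4 vx vb wx wb.
rewrite vE -mulgA in xvE; rewrite vE -mulgA in bvE.
rewrite wE -mulgA in xwE; rewrite wE -mulgA in bwE.
have [zx [zx1 zx2]] := good_lcm gx xvE xwE.
have [zb [zb1 zb2]] := good_lcm gb bvE bwE.
move: xn gx gb; rewrite xvE bvE lenM len_aw add1n ltnS => xn gx gb.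
have [j1 [vj1 [p pE] [x1 x1E] [b1 b1E]]] :
    exists j, [/\ ldvd v' j, ldvd (c t s) j, ldvd j (v' * xv) & ldvd j (v' * bv)].
  apply: IH => //; try exact: ldvd_mulr; try solve [exact: goodM gx | exact: goodM gb].
    by rewrite zx1; exact: ldvd_mulr.
  by rewrite zb1; exact: ldvd_mulr.
have tj : gen s * j1 = gen t * (c s t * p) by rewrite pE !mulgA aw_alt_pred.
move: (gx) (gb); rewrite -xvE -bvE xwE bwE => gx' gb'.
have xE : w' * xw = c s t * p * x1.
  apply: good_cancel gx' _; by rewrite -xwE xvE x1E mulgA tj !mulgA.
have bE : w' * bw = c s t * p * b1.
  apply: good_cancel gb' _; by rewrite -bwE bvE b1E mulgA tj !mulgA.
have [j2 [rj2 wj2 jx2 jb2]] :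
    exists j, [/\ ldvd (c s t * p) j, ldvd w' j, ldvd j (w' * xw) & ldvd j (w' * bw)].
  apply: IH; try exact: ldvd_mulr; try solve [exact: goodM gx' | exact: goodM gb'];
    rewrite ?xE ?bE; try exact: ldvd_mulr.
  rewrite -xE; have := congr1 len (etrans (esym xwE) xvE).
  by rewrite !len_gen => -[->].
exists (gen t * j2); split.
- rewrite vE; apply: ldvd_trans (ldvd_mul2l _ vj1) _.
  by rewrite tj; exact: ldvd_mul2l.
- by rewrite wE; exact: ldvd_mul2l.
- exact: ldvd_mul2l.
- exact: ldvd_mul2l.
Qed.

Lemma left_exchange s p : reduced m p -> ~ reduced m (s :: p) ->
  exists p', reduced m (s :: p') /\ aw m p = aw m (s :: p').
Proof.
move=> rp /(not_reduced_cons rp) /mem_refl [p1 [a [p2 [pE E]]]].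
have cE : cw m p = cw m (s :: p1 ++ p2).
  rewrite cw_cons (cw_cat _ p1) mulgA E pE (cw_cat _ p1 [:: a]) -mulgA.
  by rewrite -cw_cons -cw_cat.
have rE : reduced m (s :: p1 ++ p2).
  by apply: reduced_eq rp; rewrite // pE /= !size_cat /= addnS.
by exists (p1 ++ p2); split=> //; exact: matsumoto.
Qed.

Lemma right_exchange t p : reduced m p -> ~ reduced m (p ++ [:: t]) ->
  exists p', aw m p = aw m (p' ++ [:: t]).
Proof.
move=> rp nr; have [||p' [rp' E]] := @left_exchange t (rev p).
- exact: reduced_rev.
- by move=> /reduced_rev; rewrite rev_cons revK -cats1.
exists (rev p'); have rE := reduced_rev rp'; apply: matsumoto => //.
  by rewrite cats1 -rev_cons.
by rewrite cats1 -rev_cons cw_rev -(aw_cw Hm E) cw_rev invgK.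
Qed.

Lemma gen_dvd_Delta s : ldvd (gen s) Delta.
Proof.
have [|p' [_ ->]] := @left_exchange s d d_reduced.
  by move/d_longest; rewrite /= ltnn.
by exists (aw m p'); rewrite -aw_cons.
Qed.

(* The composites of two instances of the lcm property around the middle letter
   [u] are compared inside [u^-1 Delta], where everything is known from the
   Coxeter group. *)
Lemma cube s t u x w y z z' : good w ->
  x = c u s * z -> w = c s u * z -> w = c t u * z' -> y = c u t * z' ->
  exists r : M, x = c t s * r /\ y = c s t * r.
Proof.
move=> gw xE wE wE' yE.
have gD := simple_good simple_Delta.
have [b bE] := gen_dvd_Delta u.
have [[bs bsE] [bt btE]] := (gen_dvd_Delta s, gen_dvd_Delta t).
have [ks [ksE _]] := good_lcm gD bE bsE.
have [kt [ktE _]] := good_lcm gD bE btE.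
have [|||||j [[j' jE] [j'' jE'] [q qE] [b' b'E]]] :=
  @good_join (len w) w b (c s u) (c t u) (leqnn _) gw.
- by apply: (@goodM (gen u)); rewrite -bE.
- by rewrite wE; exact: ldvd_mulr.
- by rewrite ksE; exact: ldvd_mulr.
- by rewrite wE'; exact: ldvd_mulr.
- by rewrite ktE; exact: ldvd_mulr.
have zE : z = j' * q.
  by apply: (@good_cancel (c s u)); rewrite -?wE // mulgA -jE.
have zE' : z' = j'' * q.
  by apply: (@good_cancel (c t u)); rewrite -?wE' // mulgA -jE'.
(* [u j] left divides [Delta], so it is simple. *)
have gj : good (gen u * j).
  apply/simple_good/(proj1 (@simpleM _ b' _)).
  by rewrite -mulgA -b'E -bE; exact: simple_Delta.
have Es : gen u * j = gen s * (c u s * j') by rewrite jE !mulgA aw_alt_pred.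
have Et : gen u * j = gen t * (c u t * j'') by rewrite jE' !mulgA aw_alt_pred.
have [r [rE rE']] := good_lcm gj Es Et.
by exists (r * q); rewrite xE yE zE zE' !mulgA rE rE'.
Qed.

(** Induction on the length, then on a derivation of [s a = t b] by braid relations. Transitivity
    through a word [u w] is [cube], where [w] is shorter and hence good. *)
Lemma all_good x : good x.
Proof.
suff H n y : len y <= n -> atom_lcm y.
  by move=> y z _; apply: H (leqnn _).
elim: n y => [|n IH] y yn s t a b ya yb.
  by move: yn; rewrite ya lenM len_aw.
have IHg w : len w <= n -> good w.
  by move=> wn u v E; apply: IH; apply: leq_trans wn; rewrite E lenM leq_addl.
suff K p q : ceq (artin_rel m) p q -> size p <= n.+1 -> size q <= n.+1 ->
    forall s t p' q', p = s :: p' -> q = t :: q' ->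
    exists z, aw m p' = c t s * z /\ aw m q' = c s t * z.
  have sa : size (s :: repr a) <= n.+1 by move: yn; rewrite ya len_gen.
  have sb : size (t :: repr b) <= n.+1 by move: yn; rewrite yb len_gen.
  rewrite -[a](wd_repr a) -[b](wd_repr b).
  apply: (K (s :: repr a) (t :: repr b) _ sa sb s t _ _ erefl erefl).
  by apply/wdP; rewrite wd_cons (wd_cons _ t) !wd_repr -[LHS]ya -[RHS]yb.
elim=> {p q s t a b ya yb y yn} [p|p q _ H|p q r pq H qr H'|u v l r [e [f [-> ->]]]].
- move=> _ _ s t p' q' -> [<- <-]; exists (aw m p').
  by rewrite alt_pred_diag // mul1g.
- move=> pn qn s t p' q' pE qE; have [z [z1 z2]] := H qn pn _ _ _ _ qE pE.
  by exists z.
- move=> pn rn s t p' r' pE rE.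
  have qn : size q <= n.+1 by rewrite -(@aw_size _ m p q) //; apply/wdP.
  have : size q = size p by apply/esym/(@aw_size _ m); apply/wdP.
  rewrite pE; case: q qn {pq qr} H H' => [//|u w] wn H H' _.
  have [z [zE wE]] := H pn wn _ _ _ _ pE erefl.
  have [z' [wE' zE']] := H' wn rn _ _ _ _ erefl rE.
  by apply: (cube (IHg (aw m w) _) zE wE wE' zE'); rewrite len_aw.
(* A relation applied at the front is itself the lcm relation of [e] and [f]; elsewhere it keeps the
   first letter. *)
have E1 : alt f e (m e f) = f :: alt_pred m e f by rewrite (m_sym Hm e f) alt_predE.
move=> _ _ s t p' q'; case: u => [|k u].
  rewrite !cat0s E1 alt_predE // => -[-> <-] [-> <-].
  by exists (aw m v); rewrite !aw_cat.
move=> [-> <-] [-> <-]; exists (aw m (u ++ alt e f (m e f) ++ v)).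
rewrite alt_pred_diag // mul1g; split=> //.
by rewrite !aw_cat (aw_braid Hm) (m_sym Hm f e).
Qed.

Lemma atom_lcmP s t a b : gen s * a = gen t * b ->
  exists z, a = c t s * z /\ b = c s t * z.
Proof. by move=> E; exact: good_lcm (@all_good (gen s * a)) _ _ _ _ erefl E. Qed.

Lemma artin_mulI x y z : x * y = x * z -> y = z.
Proof. exact/good_cancel/all_good. Qed.

(** * Divisors of [Delta] and centrality of its square *)

Lemma ldvd_alt s t x : ldvd (gen s) x -> ldvd (gen t) x ->
  ldvd (aw m (alt s t (m s t))) x.
Proof.
move=> [a ->] [b E]; have [z [-> _]] := atom_lcmP E.
by exists z; rewrite alt_predE // (aw_cons _ s (alt_pred _ _ _)) mulgA.
Qed.

(** In a longer alternating word, a braid relation on the first [m s t] letters brings two equal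
    letters together. *)
Lemma reduced_alt_leq s t k : reduced m (alt s t k) -> k <= m s t.
Proof.
rewrite leqNgt => rk; apply/negP => mk; move: rk.
rewrite -(subnKC mk) alt_add => /reduced_catl; rewrite altSr.
have := m_gt0 Hm s t; have := cw_braid Hm s t; rewrite (m_sym Hm t s).
case: (m s t) => // k' E _ /(_ (alt t s k')).
rewrite cw_cat E altSr -cw_cat -catA cw_cat.
rewrite size_cat !size_alt addn1 => H.
suff /H : cw m (alt t s k') = cw m (alt t s k') *
    cw m ([:: if odd k' then s else t] ++ [:: if odd k'.+1 then t else s]).
  by move=> /ltnW; rewrite ltnn.
by rewrite [odd k'.+1]/=; case: (odd k') => /=; rewrite cw_cons cw_sq mulg1.
Qed.

(* A reduced word of length at least 2 is [q ++ alt s t k] with [k >= 2] and [q]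
   minimal modulo the dihedral subgroup generated by [s] and [t]; then [q ++ [s]]
   and [q ++ [t]] are shorter reduced words. *)
Lemma reduced_ldvd x : (forall s, ldvd (gen s) x) ->
  forall p, reduced m p -> ldvd (aw m p) x.
Proof.
move=> sx p; elim: {p}(size p).+1 {-2}p (ltnSn (size p)) => // n IH p pn rp.
have K q s t k : s != t -> 1 < k -> reduced m (q ++ alt s t k) ->
    size q + k <= n -> ldvd (aw m (q ++ alt s t k)) x.
  elim: {q}(size q).+1 {-2}q (ltnSn (size q)) s t k => // l IHl q ql s t k st k1 rq qk.
  have rqs : reduced m (q ++ [:: s]).
    by move: rq; case: k k1 {qk} => // k _; rewrite altS -cat1s catA => /reduced_catl.
  have rql : reduced m q := reduced_catl rqs.
  case: (pselect (reduced m (q ++ [:: t]))) => [rqt|/(right_exchange rql) [q' E]].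
    have [a aE] : ldvd (aw m (q ++ [:: s])) x.
      apply: IH => //.
      by rewrite size_cat /= (leq_trans _ qk) // -addnS leq_add2l k1.
    have [b bE] : ldvd (aw m (q ++ [:: t])) x.
      apply: IH => //.
      by rewrite size_cat /= (leq_trans _ qk) // -addnS leq_add2l k1.
    have xE : x = aw m q * (gen s * a) by rewrite mulgA -aw_cat.
    have yE : gen s * a = gen t * b.
      by apply: (@artin_mulI (aw m q)); rewrite -xE mulgA -aw_cat.
    rewrite xE aw_cat; apply: ldvd_mul2l.
    have km := reduced_alt_leq (reduced_catr rq).
    apply: ldvd_trans (ldvd_alt (t := t) (ldvd_mulr _ _) _); last first.
      by rewrite yE; exact: ldvd_mulr.
    by rewrite -(subnKC km) alt_add aw_cat; exact: ldvd_mulr.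
  (* The exchange makes [q] end in [t]; this letter joins the alternating part, and the prefix gets
     shorter. *)
  have AE : aw m (q ++ alt s t k) = aw m (q' ++ alt t s k.+1).
    by rewrite altS -cat1s catA !(aw_cat _ _ (alt _ _ _)) E.
  have qs := aw_size E; rewrite size_cat addn1 in qs.
  rewrite AE; apply: IHl; rewrite ?(eq_sym t) ?addnS -?addSn -?qs //.
    exact: ltnW.
  by apply: reduced_eq rq; [exact: aw_cw AE | exact: aw_size AE].
case: (lastP p) pn rp => [|p1 s] pn rp; first exact: ldvd1.
case: (lastP p1) pn rp => [|p2 t] pn rp; first exact: sx.
move: pn rp; rewrite !size_rcons -!cats1 -catA => pn rp.
apply: (K p2 t s 2) => //; last by rewrite addn2.
apply/eqP=> ts; move: rp; rewrite ts => /reduced_catr /(_ [::]) /=.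
by rewrite (cw_cons _ s [:: s]) cw_sq => /(_ erefl).
Qed.

Lemma reduced_dvd_Delta p : reduced m p -> ldvd (aw m p) Delta.
Proof. exact/reduced_ldvd/gen_dvd_Delta. Qed.

Lemma len_eq1 x : len x = 1%N -> exists s, x = gen s.
Proof.
case: (artinP x) => [->|[s [y ->]]]; first by rewrite len1.
by rewrite len_gen => -[/len_eq0 ->]; exists s; rewrite mulg1.
Qed.

(** Write [Delta = s y]. As [y] is simple, it left divides [Delta], and by length the quotient is a
    letter [s']; so [s Delta = s y s' = Delta s']. *)
Lemma gen_Delta s : exists s', gen s * Delta = Delta * gen s'.
Proof.
have [y yE] := gen_dvd_Delta s.
have [_ [p rp pE]] : simple (gen s) /\ simple y.
  by apply: simpleM; rewrite -yE; exact: simple_Delta.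
have [z zE] := reduced_dvd_Delta rp; rewrite -pE in zE.
have [s' s'E] : exists s', z = gen s'.
  by apply: len_eq1; apply/eqP; rewrite -(eqn_add2l (len y)) -lenM -zE yE len_gen addn1.
by exists s'; rewrite {2}yE -mulgA -s'E -zE.
Qed.

Definition artin_rev x : M := aw m (rev (repr x)).

Lemma artin_rev_aw p : artin_rev (aw m p) = aw m (rev p).
Proof.
suff H q r : ceq (artin_rel m) q r -> aw m (rev q) = aw m (rev r).
  by apply: H; apply/wdP; rewrite wd_repr.
elim=> [//|? ? _ ->//|? ? ? _ -> _ //|u v _ _ [s [t [-> ->]]]].
rewrite !rev_cat !aw_cat !rev_alt (m_sym Hm s t).
by case: (odd _); rewrite (aw_braid Hm t s) (m_sym Hm s t).
Qed.

Lemma artin_revM x y : artin_rev (x * y) = artin_rev y * artin_rev x.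
Proof.
by rewrite -[x](wd_repr x) -[y](wd_repr y) -wd_cat !artin_rev_aw rev_cat aw_cat.
Qed.

Lemma artin_rev_Delta : artin_rev Delta = Delta.
Proof.
rewrite artin_rev_aw; have [z E] := reduced_dvd_Delta (reduced_rev d_reduced).
have /len_eq0 z1 : len z = 0%N.
  apply/eqP; rewrite -(eqn_add2l (len (aw m (rev d)))) -lenM -E !len_aw size_rev.
  by rewrite addn0.
by rewrite E z1 mulg1.
Qed.

(** Reversing words fixes [Delta], so conjugation by [Delta] is an involution on the letters. *)
Lemma Delta_gen s s' : gen s * Delta = Delta * gen s' ->
  Delta * gen s = gen s' * Delta.
Proof.
by move/(congr1 artin_rev); rewrite !artin_revM artin_rev_Delta !artin_rev_aw.
Qed.

Local Notation E := (Delta * Delta).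

Lemma commute_gen x : (forall s, commute x (gen s)) -> forall y, commute x y.
Proof.
move=> xs; elim/artin_ind => [|s y IH]; first exact: commute1.
exact: commuteM.
Qed.

Lemma Delta2_central x : commute E x.
Proof.
apply: commute_gen => s; have [s' Es] := gen_Delta s.
by rewrite /commute -mulgA (Delta_gen Es) !mulgA Es.
Qed.

Lemma gen_complement s : exists q, gen s * aw m q = E /\ aw m q * gen s = E.
Proof.
have [y yE] := gen_dvd_Delta s; exists (repr (y * Delta)).
have -> : aw m (repr (y * Delta)) = y * Delta by exact: wd_repr.
have E1 : gen s * (y * Delta) = E by rewrite mulgA -yE.
split=> //; apply: (@artin_mulI (gen s)).
by rewrite mulgA E1; exact: Delta2_central.
Qed.

(** * Conjugation of powers of letters, and quasicentral elements *)

Lemma alt_pred_gen s t : s != t -> exists p, alt_pred m s t = s :: p.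
Proof.
move=> st; have : 2 <= m s t by have [_ [_ ->]] := Hm s t.
rewrite /alt_pred; case: (m s t) => [//|[//|k]] _.
by rewrite /= altS; exists (alt t s k).
Qed.

(** Stripping one [t] leaves a multiple of [c u t], which again begins with [u]. *)
Lemma dvd_gen_power u t k x : u != t -> ldvd (gen u) (gen t ^+ k.+1 * x) ->
  ldvd (c u t) x.
Proof.
move=> ut; elim: k => [|k IH] [y E].
  by rewrite expg1 in E; have [z [-> _]] := atom_lcmP E; exact: ldvd_mulr.
rewrite expgS -mulgA in E; have [z [zE _]] := atom_lcmP E.
apply: IH; rewrite zE; have [p ->] := alt_pred_gen ut.
by rewrite (aw_cons _ u p) -mulgA; exact: ldvd_mulr.
Qed.

(** The left side is the braid word; its other spelling is [alt_pred u t] followed by one letter. *)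
Lemma gen_alt_pred u t : exists t', gen t * c u t = c u t * gen t'.
Proof.
rewrite -aw_cons -alt_predE // aw_braid // /alt_pred -{1}(prednK (m_gt0 Hm u t)).
by rewrite altSr aw_cat; eexists.
Qed.

Lemma power_conj n s t x : 0 < n -> x * gen s ^+ n = gen t ^+ n * x ->
  x * gen s = gen t * x.
Proof.
case: n => // n _; elim: {x}(len x).+1 {-2}x (ltnSn (len x)) s t => // l IH x xl s t E.
(* Here [x = c u t * y]; moving the powers of [t] through [c u t] turns them into powers of [t'],
   and the shorter [y] satisfies the same kind of equation. *)
have D u : u != t -> ldvd (gen u) (gen t ^+ n.+1 * x) ->
    x * gen s = gen t * x.
  move=> ut /(dvd_gen_power ut) [y yE]; have [t' tE] := gen_alt_pred u t.
  have tnE k : gen t ^+ k * c u t = c u t * gen t' ^+ k.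
    elim: k => [|k IHk]; first by rewrite mul1g mulg1.
    by rewrite !expgS -mulgA IHk mulgA tE mulgA.
  have Ey : y * gen s ^+ n.+1 = gen t' ^+ n.+1 * y.
    by apply: (@artin_mulI (c u t)); rewrite mulgA -yE E yE !mulgA tnE.
  have yl : len y < l.
    rewrite -ltnS; apply: leq_ltn_trans xl; rewrite yE; have [p ->] := alt_pred_gen ut.
    by rewrite (aw_cons _ u p) -mulgA len_gen ltnS lenM leq_addl.
  by rewrite yE -mulgA (IH y yl _ _ Ey) mulgA -tE mulgA.
case: (artinP x) => [x1|[u [y yE]]].
  case: (eqVneq s t) => [->|st]; first by rewrite x1 mulg1 mul1g.
  by apply: (D s) => //; rewrite -E x1 mul1g expgS; exact: ldvd_mulr.
case: (eqVneq u t) => [ut|ut]; last first.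
  by apply: (D u) => //; rewrite -E yE -mulgA; exact: ldvd_mulr.
subst u; rewrite yE -mulgA (IH y _ s t) //.
  by move: xl; rewrite yE len_gen.
by apply: (@artin_mulI (gen t)); rewrite mulgA -yE E yE !mulgA -expgS -expgSr.
Qed.

Lemma quasicentral_Delta x : IrreducibleW m ->
  (forall s, exists s', gen s * x = x * gen s') -> exists k, x = Delta ^+ k.
Proof.
move=> irr; elim: {x}(len x).+1 {-2}x (ltnSn (len x)) => // l IH x xl xq.
case: (artinP x) => [->|[s [y yE]]]; first by exists 0%N.
have all_dvd u : ldvd (gen u) x.
  pose A := [set u | `[< ldvd (gen u) x >]].
  suff /setP/(_ u) : A = setT by rewrite !inE => /asboolP.
  apply/eqP/negPn/negP => AT; have [|s1 [u1 []]] := irr A _ AT.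
    by apply/set0Pn; exists s; rewrite inE; apply/asboolP; rewrite yE; exact: ldvd_mulr.
  rewrite !inE => /asboolP s1x /asboolP u1x mn2; apply: u1x.
  case: (eqVneq s1 u1) => [<- //|su].
  (* Both [u1] and [s1] divide [u1 x = x u'], so [x] begins with [s1 u1] because [m s1 u1 > 2].
     Cancelling [s1] in [s1 x = x s'] then shows that [x] begins with [u1]. *)
  have [u' uE] := xq u1; have [s' sE] := xq s1; have [w wE] := s1x.
  have [z [zE _]] : exists z, x = c s1 u1 * z /\ w * gen u' = c u1 s1 * z.
    by apply: atom_lcmP; rewrite uE mulgA -wE.
  have : 2 < m s1 u1.
    by rewrite ltn_neqAle eq_sym mn2; have [_ [_ -> //]] := Hm s1 u1.
  move: zE; rewrite /alt_pred; case: (m s1 u1) => [//|[//|[//|k]]] + _.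
  rewrite /= !altS (aw_cons _ s1) (aw_cons _ u1) -!mulgA => xE.
  rewrite xE -!mulgA in sE; have {}sE := artin_mulI sE.
  by rewrite xE sE; exact: ldvd_mulr.
have [z zE] := reduced_ldvd all_dvd d_reduced.
have [||k kE] := IH z.
- move: xl; rewrite zE lenM ltnS; apply: leq_trans.
  have [v vE] := gen_dvd_Delta s.
  by rewrite -add1n leq_add2r vE len_gen.
- move=> t; have [t' tE] := gen_Delta t; have [t2 t2E] := xq t'.
  exists t2; apply: (@artin_mulI Delta).
  by rewrite mulgA (Delta_gen tE) -(mulgA (gen t')) -zE t2E zE mulgA.
by exists k.+1; rewrite expgS -kE.
Qed.

End Garside.

(** * Passage to the quotient of the Artin group *)

Section PresentedGroup.
Variables (S : finType) (R : word S -> word S -> Prop).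
Implicit Types u v w : word S.
Local Notation "u ~~~ v" := (peq R u v) (at level 70).

Lemma peq_ctx a b u v : u ~~~ v -> a ++ u ++ b ~~~ a ++ v ++ b.
Proof.
elim=> [{}u|{}u {}v _|{}u {}v w _ uv _ vw|{}u {}v s e|{}u {}v l r Rlr].
- exact: peq_refl.
- exact: peq_sym.
- exact: peq_trans uv vw.
- by have := peq_free R (a ++ u) (v ++ b) s e; rewrite -!catA.
by have := peq_rel (a ++ u) (v ++ b) Rlr; rewrite -!catA.
Qed.

Lemma peq_cat u u' v v' : u ~~~ u' -> v ~~~ v' -> u ++ v ~~~ u' ++ v'.
Proof.
move=> /(peq_ctx [::] v) /= uu /(peq_ctx u' [::]); rewrite !cats0.
exact: peq_trans.
Qed.

Lemma peq_catl a u v : u ~~~ v -> a ++ u ~~~ a ++ v.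
Proof. by apply: peq_cat; exact: peq_refl. Qed.

Lemma peq_catr b u v : u ~~~ v -> u ++ b ~~~ v ++ b.
Proof. by move=> uv; apply: peq_cat => //; exact: peq_refl. Qed.

Lemma winv_cat u v : winv (u ++ v) = winv v ++ winv u.
Proof. by rewrite /winv map_cat rev_cat. Qed.

Lemma winvK : involutive (@winv S).
Proof.
move=> w; rewrite /winv map_rev revK -map_comp -[RHS]map_id.
by apply: eq_map => -[s b] /=; rewrite negbK.
Qed.

Lemma peq_mulV w : w ++ winv w ~~~ [::].
Proof.
elim: w => [|[s b] w IH]; first exact: peq_refl.
rewrite -cat1s winv_cat catA -(catA [:: (s, b)]).
apply: peq_trans (peq_ctx [:: (s, b)] (winv [:: (s, b)]) IH) _.
exact: (peq_free R [::] [::]).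
Qed.

Lemma peq_Vmul w : winv w ++ w ~~~ [::].
Proof. by rewrite -{2}(winvK w); exact: peq_mulV. Qed.

Lemma peq_winv u v : u ~~~ v -> winv u ~~~ winv v.
Proof.
move=> uv; have /peq_sym := peq_catl (winv u) (peq_mulV v); rewrite cats0 => H.
apply: peq_trans H _; rewrite catA -[X in _ ~~~ X]cat0s; apply: peq_catr.
by apply: peq_trans (peq_catl _ (peq_sym uv)) _; exact: peq_Vmul.
Qed.

End PresentedGroup.

(** * Comparison of the quotient group with the Artin monoid *)

Section Fractions.
Variables (S : finType) (m : S -> S -> nat).
Hypothesis Hm : CoxeterMatrix m.
Variable d : seq S.
Hypothesis d_reduced : reduced m d.
Hypothesis d_longest : forall q, reduced m q -> size q <= size d.
Local Notation M := (artin m).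
Local Notation gen s := (aw m [:: s]).
Local Notation Delta := (aw m d).
Local Notation E := (Delta * Delta).

Definition compl s : seq S := sval (cid (gen_complement Hm d_reduced d_longest s)).

Lemma complP s : gen s * aw m (compl s) = E /\ aw m (compl s) * gen s = E.
Proof. exact: svalP (cid (gen_complement Hm d_reduced d_longest s)). Qed.

(* In [G] the inverse of [s] equals the positive word [compl s]. *)
Fixpoint positive (w : word S) : seq S :=
  if w is (s, b) :: w' then (if b then compl s else [:: s]) ++ positive w' else [::].

Definition phi (w : word S) : M := aw m (positive w).

Lemma positive_cat u v : positive (u ++ v) = positive u ++ positive v.
Proof. by elim: u => //= -[s b] u ->; rewrite catA. Qed.

Lemma phi_cat u v : phi (u ++ v) = phi u * phi v.
Proof. by rewrite /phi positive_cat aw_cat. Qed.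

Lemma positive_pos p : positive (pos p) = p.
Proof. by elim: p => //= s p ->. Qed.

Lemma phi_pos p : phi (pos p) = aw m p.
Proof. by rewrite /phi positive_pos. Qed.

Lemma phi_cancel s b : phi [:: (s, b); (s, ~~ b)] = E.
Proof.
rewrite /phi; case: b; rewrite /= ?cats0 ?(aw_cons _ s (compl s)) ?aw_cat;
  by case: (complP s).
Qed.

Lemma E_central n x : E ^+ n * x = x * E ^+ n.
Proof.
apply/esym/commuteX/commute_sym; exact: (Delta2_central Hm d_reduced d_longest).
Qed.

Lemma E_swap x y : x * (E * y) = E * (x * y).
Proof.
by rewrite (mulgA x E y) -(Delta2_central Hm d_reduced d_longest x) -(mulgA E).
Qed.

Lemma phi_mulV w : phi (w ++ winv w) = E ^+ size w.
Proof.
elim: w => [|[s b] w IH] //.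
rewrite -cat1s winv_cat -catA (catA w) !phi_cat -(phi_cat w) IH E_central mulgA.
by rewrite -phi_cat /= phi_cancel expgS.
Qed.

Definition fraction_eq u v := exists k l, E ^+ k * phi u = E ^+ l * phi v.

Lemma Geq_fraction u v : Geq m d u v -> fraction_eq u v.
Proof.
elim=> [w|{}u {}v _ [k [l H]]|{}u {}v w _ [k [l H]] _ [k' [l' H']]|{}u {}v s b
  |{}u {}v l r].
- by exists 0%N, 0%N.
- by exists l, k.
- exists (k' + k)%N, (l + l')%N; rewrite !expgnDr -mulgA H -mulgA -H'.
  by rewrite !mulgA E_central.
- by exists 0%N, 1%N; rewrite !phi_cat phi_cancel mul1g expg1 E_swap.
case=> [[s [t [-> ->]]]|[-> ->]].
  by exists 0%N, 0%N; rewrite !phi_cat !phi_pos (aw_braid Hm) (m_sym Hm t s).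
by exists 0%N, 1%N; rewrite !phi_cat !phi_pos mul1g expg1 E_swap.
Qed.

Lemma pos_cat (p q : seq S) : pos (p ++ q) = pos p ++ pos q.
Proof. exact: map_cat. Qed.

Lemma aw_Geq p q : aw m p = aw m q -> Geq m d (pos p) (pos q).
Proof.
move/wdP; elim=> [r|{}p {}q _|{}p {}q r _ pq _ qr|u v _ _ [s [t [-> ->]]]].
- exact: peq_refl.
- exact: peq_sym.
- exact: peq_trans pq qr.
by rewrite !pos_cat; apply: peq_rel; left; exists s, t.
Qed.

Lemma Geq_Delta2 : Geq m d (pos (d ++ d)) [::].
Proof.
by rewrite pos_cat -[_ ++ _]cats0; apply: (@peq_rel _ _ [::] [::] _ [::]); right.
Qed.

Lemma Geq_positive w : Geq m d (pos (positive w)) w.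
Proof.
elim: w => [|[s b] w IH] /=; first exact: peq_refl.
rewrite pos_cat -[(s, b) :: w]cat1s; apply: peq_cat => //.
case: b; last exact: peq_refl.
have E1 : Geq m d (pos (s :: compl s)) [::].
  apply: peq_trans Geq_Delta2; apply: aw_Geq.
  by rewrite aw_cons aw_cat; case: (complP s).
apply: peq_trans (_ : Geq m d ([:: (s, true)] ++ pos (s :: compl s)) _).
  by apply: peq_sym; exact: (peq_free _ [::] _ s true).
exact: (peq_catl _ E1).
Qed.

Fixpoint dd n := if n is n'.+1 then (d ++ d) ++ dd n' else [::].

Lemma aw_dd n : aw m (dd n) = E ^+ n.
Proof. by elim: n => //= n IH; rewrite !aw_cat IH expgS. Qed.

Lemma Geq_dd n : Geq m d (pos (dd n)) [::].
Proof.
elim: n => [|n IH]; first exact: peq_refl.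
by rewrite pos_cat; apply: (peq_cat Geq_Delta2 IH).
Qed.

Lemma fraction_Geq u v : fraction_eq u v -> Geq m d u v.
Proof.
move=> [k [l]]; rewrite -!aw_dd -!aw_cat => /aw_Geq H.
have D n w : Geq m d (pos (dd n ++ positive w)) w.
  by rewrite pos_cat; exact: (peq_cat (Geq_dd n) (Geq_positive w)).
exact: peq_trans (peq_sym (D k u)) (peq_trans H (D l v)).
Qed.

Lemma len_E_gt0 (s : S) : 0 < len E.
Proof.
have [z ->] := gen_dvd_Delta Hm d_reduced d_longest s.
by rewrite -mulgA len_gen.
Qed.

(** Lengths force [k = l]. The letter [s] guarantees that [E] has positive length. *)
Lemma fraction_len (s : S) k l (x y : M) : len x = len y ->
  E ^+ k * x = E ^+ l * y -> x = y.
Proof.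
move=> xy H; have := congr1 (@len S m) H; rewrite !lenM !lenX xy => /addIn /eqP.
rewrite eqn_pmul2r ?(len_E_gt0 s) // => /eqP kl.
by move: H; rewrite kl => /(artin_mulI Hm d_reduced d_longest).
Qed.

Lemma central_of_gen g : (forall s, phi g * gen s = gen s * phi g) ->
  (forall h, Geq m d (conjw h g) g) /\ central (gRel m d) g.
Proof.
move=> gs; have gc x : commute (phi g) x by exact: commute_gen.
split=> h; apply: fraction_Geq.
  exists 0%N, (size h); rewrite mul1g /conjw !phi_cat mulgA -gc -mulgA -phi_cat.
  by rewrite phi_mulV E_central.
by exists 0%N, 0%N; rewrite !mul1g !phi_cat gc.
Qed.

Lemma finite_orbit_power g s : finite_conj_orbit (gRel m d) g ->
  exists2 n, 0 < n & phi g * gen s ^+ n = gen s ^+ n * phi g.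
Proof.
move=> [os osP]; pose sn (i : nat) := pos (nseq i s).
have [f fP] : exists f : 'I_(size os).+1 -> word S,
    forall i, f i \in os /\ Geq m d (conjw (sn i) g) (f i).
  apply: (@fin_all_exists _ _ (fun (i : 'I_(size os).+1) u =>
    u \in os /\ Geq m d (conjw (sn i) g) u)) => i.
  by have [u] := osP (sn i); exists u.
have /injectivePn [i [j ij fij]] : ~~ injectiveb f.
  apply/negP=> /injectiveP fi.
  have : size (map f (enum 'I_(size os).+1)) <= size os.
    apply: uniq_leq_size; first by rewrite map_inj_uniq // enum_uniq.
    by move=> _ /mapP[k _ ->]; case: (fP k).
  by rewrite size_map size_enum_ord ltnn.
have {fP fij} H : Geq m d (conjw (sn i) g) (conjw (sn j) g).
  by apply: peq_trans (proj2 (fP i)) _; rewrite fij; apply: peq_sym; case: (fP j).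
wlog lij : i j ij H / (i < j)%N.
  move=> W; have : (i : nat) != j by [].
  rewrite neq_ltn => /orP[]; first exact: W.
  by apply: W; rewrite 1?eq_sym //; exact: peq_sym.
exists (j - i)%N; first by rewrite subn_gt0.
have [k [l]] := Geq_fraction H; rewrite /conjw !phi_cat !phi_pos.
have phiV n : phi (winv (sn n)) * gen s ^+ n = E ^+ n.
  have := phi_mulV (winv (sn n)); rewrite winvK phi_cat phi_pos /winv size_rev.
  by rewrite !size_map size_nseq /aw wd_nseq.
have AE n : aw m (nseq n s) = gen s ^+ n by exact: wd_nseq.
set n := (j - i)%N; have jE : gen s ^+ j = gen s ^+ i * gen s ^+ n.
  by rewrite -expgnDr subnKC // ltnW.
(* Multiplying by [s ^ j] on the right turns the formal inverses into powers of [E]; the remaining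
   factors have equal length on both sides. *)
rewrite !AE => /(congr1 (fun x => x * gen s ^+ j)).
have -> : E ^+ k * (gen s ^+ i * (phi g * phi (winv (sn i)))) * gen s ^+ j
    = E ^+ (k + i) * (gen s ^+ i * (phi g * gen s ^+ n)).
  rewrite jE expgnDr -!mulgA (mulgA (phi (winv _))) phiV.
  by rewrite (E_central i (gen s ^+ n)) (E_central i (gen s ^+ i * _)) !mulgA.
have -> : E ^+ l * (gen s ^+ j * (phi g * phi (winv (sn j)))) * gen s ^+ j
    = E ^+ (l + j) * (gen s ^+ i * (gen s ^+ n * phi g)).
  by rewrite expgnDr -!mulgA phiV (mulgA (gen s ^+ i)) -jE (E_central j) -!mulgA.
move=> /(fraction_len s) H2.
apply: (artin_mulI Hm d_reduced d_longest (x := gen s ^+ i)); apply: H2.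
by rewrite !lenM (addnC (len (phi g))).
Qed.

Lemma finite_orbit_central g : finite_conj_orbit (gRel m d) g ->
  (forall h, Geq m d (conjw h g) g) /\ central (gRel m d) g.
Proof.
move=> fg; apply: central_of_gen => s; have [n n0 E] := finite_orbit_power s fg.
exact: (power_conj Hm d_reduced d_longest n0 E).
Qed.

(** Comparing lengths lifts centrality to the monoid, where [phi g] is a power of [Delta]; modulo
    [E] only the parity of its exponent matters. *)
Lemma central_trivial_or_Delta g : IrreducibleW m -> central (gRel m d) g ->
  Geq m d g [::] \/ Geq m d g (pos d).
Proof.
move=> irr cg.
have [|k kE] := quasicentral_Delta Hm d_reduced d_longest (x := phi g) irr.
  move=> s; exists s; have [k [l]] := Geq_fraction (cg (pos [:: s])).
  rewrite !phi_cat phi_pos; apply: (fraction_len s).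
  by rewrite !lenM addnC.
have {}kE : phi g = E ^+ k./2 * Delta ^+ odd k.
  by rewrite kE -{1}(odd_double_half k) -mul2n addnC expgnDr expgnA.
case: (odd k) kE => kE; [right|left]; apply: fraction_Geq; exists 0%N, k./2.
  by rewrite phi_pos kE mul1g.
by rewrite kE mul1g.
Qed.

End Fractions.

(** * Translation of the hypotheses on [d] to the monoid presentation of the Coxeter group *)

Section Delta.
Variables (S : finType) (m : S -> S -> nat) (d : seq S).

Lemma ceq_Coxeq p q : ceq (coxeter_rel m) p q -> CoxeterMatrix m ->
  Coxeq m (pos p) (pos q).
Proof.
move=> pq Hm; elim: pq => [r|{}p {}q _|{}p {}q r _ pq _ qr|u v l _ [-> lE]].
- exact: peq_refl.
- exact: peq_sym.
- exact: peq_trans pq qr.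
rewrite !pos_cat; apply: peq_rel; case: lE => [[s ->]|[s [t ->]]]; exists s.
  by exists s; rewrite m_diag.
by exists t.
Qed.

Lemma fst_pos p : map fst (pos p) = p :> seq S.
Proof. by rewrite -map_comp map_id. Qed.

(** Signs of letters can be forgotten because the generators are involutions. *)
Lemma Coxeq_cw u v : Coxeq m u v -> cw m (map fst u) = cw m (map fst v).
Proof.
elim=> [//|? ? _ ->//|? ? ? _ -> _ //|{}u {}v s b|{}u {}v _ _ [s [t [-> ->]]]].
  by rewrite !map_cat !cw_cat /= (cw_cons m s [:: s]) cw_sq mul1g.
by rewrite !map_cat fst_pos [map _ [::]]/= cat0s !cw_cat cw_alt2 mul1g.
Qed.

Lemma Coxeq_pos_cw p q : Coxeq m (pos p) (pos q) -> cw m p = cw m q.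
Proof. by move/Coxeq_cw; rewrite !fst_pos. Qed.

Lemma IsDelta_reduced : CoxeterMatrix m -> IsDelta m d -> reduced m d.
Proof. by move=> Hm [dmin _] q /wdP/ceq_Coxeq/(_ Hm)/dmin. Qed.

Lemma IsDelta_longest q : IsDelta m d -> reduced m q -> size q <= size d.
Proof.
move=> [_ dmax] rq; have [p [pd /Coxeq_pos_cw/rq qp]] := dmax (pos q).
exact: leq_trans qp pd.
Qed.

End Delta.

(** * Centers of finite index subgroups, and the theorem *)

Lemma center_finite_orbit (S : finType) (R : word S -> word S -> Prop)
  (H : word S -> Prop) z : IsSubgroup R H -> FiniteIndex R H -> centerOf R H z ->
  finite_conj_orbit R z.
Proof.
move=> [_ _ _ HV] [ts tsP] [_ zc]; exists (map (fun t => conjw (winv t) z) ts) => w.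
(* Decomposing the inverse of [w] gives [w = t^-1 h^-1], with [h] next to [z]; hence
   [w z w^-1 = t^-1 z t]. *)
have [t tts [h [Hh E]]] := tsP (winv w).
exists (conjw (winv t) z); first exact: map_f.
have {}E : peq R w (winv t ++ winv h).
  by have := peq_winv E; rewrite winvK winv_cat.
apply: peq_trans (peq_cat E (peq_catl z (peq_winv E))) _.
rewrite winv_cat winvK /conjw -!catA; apply: peq_catl; rewrite !winvK catA.
apply: peq_trans (peq_catr _ (peq_sym (zc _ (HV _ Hh)))) _.
rewrite -catA; apply: peq_catl; rewrite catA -[X in peq _ _ X]cat0s.
exact/peq_catr/peq_Vmul.
Qed.

Theorem theorem4p8 (S : finType) (m : S -> S -> nat) (d : seq S)
  (Hm : CoxeterMatrix m) (Hfin : FiniteW m) (Hirr : IrreducibleW m)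
  (Hna : NonabelianW m) (Hd : IsDelta m d) :
  (forall g : word S, finite_conj_orbit (gRel m d) g ->
     (forall h, Geq m d (conjw h g) g) /\ central (gRel m d) g) /\
  (forall H : word S -> Prop,
     IsSubgroup (gRel m d) H -> FiniteIndex (gRel m d) H ->
     (forall z, centerOf (gRel m d) H z <-> Geq m d z [::]) \/
     ((forall z, centerOf (gRel m d) H z <-> (Geq m d z [::] \/ Geq m d z (pos d)))
      /\ central (gRel m d) (pos d))).
Proof.
have dr := IsDelta_reduced Hm Hd.
have dl q := @IsDelta_longest _ m d q Hd.
have orb := finite_orbit_central Hm dr dl.
split=> [//|H sH iH].
have HE := sH; case: HE => Heq H1 _ _.
have cen z : centerOf (gRel m d) H z -> central (gRel m d) z.
  by move/(center_finite_orbit sH iH)/orb => [].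
have cen_transfer z z' : central (gRel m d) z -> Geq m d z z' -> central (gRel m d) z'.
  move=> cz zz h; apply: peq_trans (peq_catl h (peq_sym zz)) _.
  exact: peq_trans (cz h) (peq_catr h zz).
have cen_in z : H z -> central (gRel m d) z -> centerOf (gRel m d) H z.
  by move=> Hz cz; split=> // h _; exact/peq_sym/cz.
have cen1 z : Geq m d z [::] -> centerOf (gRel m d) H z.
  move=> z1; apply: cen_in; first exact: Heq (peq_sym z1) H1.
  apply: cen_transfer (peq_sym z1) => h; rewrite cats0; exact: peq_refl.
(* A nontrivial element of the center of [H] is central in the whole group, so it equals [Delta];
   this puts [Delta] in [H] and makes it central. *)
case: (pselect (exists2 z, centerOf (gRel m d) H z & ~ Geq m d z [::]))
  => [[z cz z1]|nz].
  have zd : Geq m d z (pos d).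
    by case: (central_trivial_or_Delta Hm dr dl Hirr (cen z cz)).
  have cd : central (gRel m d) (pos d) := cen_transfer _ _ (cen z cz) zd.
  have Hpd : H (pos d) by apply: Heq zd _; case: cz.
  right; split=> // y; split=> [/cen|[|yd]]; last 1 first.
  - apply: cen_in; first exact: Heq (peq_sym yd) Hpd.
    exact: cen_transfer cd (peq_sym yd).
  - exact: central_trivial_or_Delta.
  exact: cen1.
left=> z; split=> [cz|]; last exact: cen1.
by apply: contrapT => z1; apply: nz; exists z.
Qed.
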